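(* Let $X$ be a Banach space and let $Y$ be a reflexive Banach space which is asymptotic-$c_0$. If there is a coarse map $f\colon X\to Y$ which is also expanding at rate $1$, then $X$ is reflexive and asymptotic-$c_0$.
   Context: A map $f\colon X\to Y$ between Banach spaces is coarse if $\omega_f(t)=\sup\{\|f(x)-f(z)\| : \|x-z\|\le t\}<\infty$ for all $t\ge 0$. A map $f\colon X\to Y$ between Banach spaces is expanding at rate $1$ if for every $L>0$ there is a map $\rho\colon[0,\infty)\to[0,\infty)$ with $\lim_{t\to\infty}\rho(t)=\infty$ such that, for all $x,z\in X$, $\|x-z\|\ge L\max\{\|x\|,\|z\|\}+L$ implies $\|f(x)-f(z)\|\ge\rho(\|x-z\|)$. For a Banach space $X$, $\mathrm{cof}(X)$ denotes the set of closed finite-codimensional subspaces of $X$ and $B_Z$ the closed unit ball of a Banach space $Z$. $X$ is asymptotic-$c_0$ if there exists $C\ge1$ such that for all $n\in\mathbb N$: $\exists X_1\in\mathrm{cof}(X)$, $\forall x_1\in B_{X_1}$, $\exists X_2\in\mathrm{cof}(X)$, $\forall x_2\in B_{X_2}$, $\dots$, $\exists X_n\in\mathrm{cof}(X)$, $\forall x_n\in B_{X_n}$, one has $\left\|\sum_{i=1}^na_ix_i\right\|\le C\max_{1\le i\le n}|a_i|$ for all $(a_i)_{i=1}^n\in\mathbb R^n$. *)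

(* Defs.v *)
From HB Require Import structures.
From mathcomp Require Import all_boot all_order all_algebra.
From mathcomp Require Import all_classical all_reals all_analysis.

Set Implicit Arguments.
Unset Strict Implicit.
Unset Printing Implicit Defensive.

Import Order.TTheory GRing.Theory Num.Theory.
Import numFieldNormedType.Exports.

Local Open Scope classical_set_scope.
Local Open Scope ring_scope.

Section Dual.
Context (R : realType) (V : normedModType R).

Definition continuous_linear : {pred V -> R^o} :=
  [pred f : V -> R^o | `[< linear f /\ continuous f >]].

Record dual := Dual {
  dual_val :> V -> R^o;
  _ : dual_val \in continuous_linear }.

HB.instance Definition _ := [isSub for dual_val].
HB.instance Definition _ := [Choice of dual by <:].

Lemma continuous_linear_submod : submod_closed continuous_linear.
Proof.
split.
  apply/asboolP; split=> [a x y|]; first by rewrite scaler0 addr0.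
  exact: cst_continuous.
move=> a f g /asboolP[lf cf] /asboolP[lg cg]; apply/asboolP; split.
  move=> k x y.
  change (a *: f (k *: x + y) + g (k *: x + y) =
    k *: (a *: f x + g x) + (a *: f y + g y)).
  by rewrite lf lg !scalerDr !scalerA mulrC addrACA.
by move=> x; apply: cvgD; [apply: cvgZl_tmp; exact: cf|exact: cg].
Qed.

HB.instance Definition _ :=
  GRing.isSubmodClosed.Build _ _ continuous_linear continuous_linear_submod.
HB.instance Definition _ := [SubChoice_isSubLmodule of dual by <:].

Implicit Types f g : dual.

Lemma dual_linear f : linear f.
Proof. by have /asboolP[] := valP f. Qed.

Lemma dual_continuous f : continuous f.
Proof. by have /asboolP[] := valP f. Qed.

HB.instance Definition _ f := GRing.isLinear.Build R V R^o _ f (dual_linear f).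

Definition dual_norm f : R := sup [set `|f x| | x in [set x : V | `|x| <= 1]].

Lemma has_sup_dual_norm f : has_sup [set `|f x| | x in [set x : V | `|x| <= 1]].
Proof.
split; first by exists `|f 0|, 0; rewrite //= normr0.
have /linear_boundedP : bounded_near f (nbhs (0 : V)).
  exact/linear_bounded_continuous/dual_continuous.
move=> /pinfty_ex_gt0[M M0 fM]; exists M => _ [x /= x1 <-].
by rewrite (le_trans (fM x))// ler_piMr// ltW.
Qed.

Lemma dual_norm_ub f x : `|x| <= 1 -> `|f x| <= dual_norm f.
Proof.
by move=> x1; apply: sup_upper_bound; [exact: has_sup_dual_norm|exists x].
Qed.

Lemma dual_norm_le f M :
  (forall x, `|x| <= 1 -> `|f x| <= M) -> dual_norm f <= M.
Proof.
move=> fM; apply: ge_sup; first by case: (has_sup_dual_norm f).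
by move=> _ [x x1 <-]; exact: fM.
Qed.

Lemma dual_norm_ge0 f : 0 <= dual_norm f.
Proof. by rewrite (le_trans _ (@dual_norm_ub f 0 _)) ?normr0. Qed.

Lemma dual_addE f g x : (f + g) x = f x + g x.
Proof. by []. Qed.

Lemma dual_scaleE (a : R) f x : (a *: f) x = a *: f x.
Proof. by []. Qed.

Lemma dual_normD f g : dual_norm (f + g) <= dual_norm f + dual_norm g.
Proof.
apply: dual_norm_le => x x1; rewrite dual_addE (le_trans (ler_normD _ _))//.
by rewrite lerD// dual_norm_ub.
Qed.

Lemma dual_normZ (a : R) f : dual_norm (a *: f) = `|a| * dual_norm f.
Proof.
apply/le_anti/andP; split.
  apply: dual_norm_le => x x1; rewrite dual_scaleE normrZ.
  by rewrite ler_wpM2l// dual_norm_ub.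
have [->|a0] := eqVneq a 0; first by rewrite normr0 mul0r dual_norm_ge0.
rewrite -ler_pdivlMl ?normr_gt0//; apply: dual_norm_le => x x1.
by rewrite ler_pdivlMl ?normr_gt0// -normrZ -dual_scaleE dual_norm_ub.
Qed.

Lemma le_dual_norm f x : `|f x| <= dual_norm f * `|x|.
Proof.
have [->|x0] := eqVneq x 0; first by rewrite linear0 !normr0 mulr0.
have x1 : `| `|x|^-1 *: x | <= 1.
  by rewrite normrZ normfV normr_id mulVf ?normr_eq0.
have := dual_norm_ub f x1.
by rewrite linearZ/= normrZ normfV normr_id mulrC ler_pdivrMr ?normr_gt0.
Qed.

Lemma dual_norm_eq0 f : dual_norm f = 0 -> f = 0.
Proof.
move=> f0; apply/val_inj/funext => x; apply/eqP.
by rewrite -normr_le0 (le_trans (le_dual_norm f x))// f0 mul0r.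
Qed.

HB.instance Definition _ :=
  Lmodule_isNormed.Build R dual dual_normD dual_normZ dual_norm_eq0.

End Dual.
Arguments dual {R} V.

Section Bidual.
Context (R : realType) (V : normedModType R).

Lemma evaluation_subproof (x : V) :
  (fun f : dual V => f x : R^o) \in @continuous_linear R (dual V).
Proof.
apply/asboolP.
have lx : linear (fun f : dual V => f x : R^o) by [].
split=> //.
pose F : {linear dual V -> R^o} :=
  HB.pack (fun f : dual V => f x : R^o) (GRing.isLinear.Build _ _ _ _ _ lx).
apply: (@bounded_linear_continuous _ _ _ F); apply/linear_boundedP.
near=> r => f; rewrite (le_trans (le_dual_norm f x))// mulrC ler_wpM2r//.
exact: dual_norm_ge0.
Unshelve. all: by end_near. Qed.

Definition bidual_embedding (x : V) : dual (dual V) :=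
  Dual (evaluation_subproof x).

Definition reflexive_space := forall F : dual (dual V),
  exists x : V, bidual_embedding x = F.

End Bidual.
Arguments reflexive_space {R} V.

Section Maps.
Context (R : realType) (X Y : normedModType R).
Implicit Type f : X -> Y.

Definition expansion_modulus f (t : R) : \bar R :=
  ereal_sup [set `|f p.1 - f p.2|%:E | p in [set p : X * X | `|p.1 - p.2| <= t]].

Definition coarse f :=
  forall t : R, 0 <= t -> (expansion_modulus f t < +oo)%E.

(* Only the values of [rho] on [0, +oo) matter. *)
Definition expanding_at_rate1 f :=
  forall L : R, 0 < L -> exists rho : R -> R,
    [/\ forall t, 0 <= t -> 0 <= rho t,
        rho t @[t --> +oo] --> +oo &
        forall x z : X, L * Num.max `|x| `|z| + L <= `|x - z| ->
          rho `|x - z| <= `|f x - f z|].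

End Maps.

Section AsymptoticC0.
Context (R : realType) (X : normedModType R).

(* [X / Z] is finite-dimensional: it is spanned by the classes of finitely
   many vectors [e i]. *)
Definition finite_codim (Z : set X) :=
  exists (k : nat) (e : 'I_k -> X),
    forall x, exists c : 'I_k -> R, Z (x - \sum_(i < k) c i *: e i).

Definition cof : set (set X) :=
  [set Z | [/\ submod_closed (mem Z), closed Z & finite_codim Z]].

(* [cof_game n P s] is "exists X_1 in cof X, for all x_1 in B_(X_1), ...,
   exists X_n in cof X, for all x_n in B_(X_n), P (s ++ [:: x_1; ...; x_n])". *)
Fixpoint cof_game (n : nat) (P : seq X -> Prop) (s : seq X) : Prop :=
  if n is m.+1 then
    exists2 Z : set X, cof Z &
      forall x : X, Z x -> `|x| <= 1 -> cof_game m P (rcons s x)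
  else P s.

(* The maximum is taken over nonnegative numbers, hence the default value 0. *)
Definition asymptotic_c0 :=
  exists2 C : R, 1 <= C & forall n : nat,
    cof_game n (fun s => forall a : 'I_n -> R,
      `|\sum_(i < n) a i *: s`_i| <= C * \big[Num.max/0]_(i < n) `|a i|) [::].

End AsymptoticC0.
Arguments asymptotic_c0 {R} X.

(* Main.v *)
Require Import Defs.
From HB Require Import structures.
From mathcomp Require Import all_boot all_order all_algebra.
From mathcomp Require Import all_classical all_reals all_analysis.
From mathcomp Require Import lra.

Set Implicit Arguments.
Unset Strict Implicit.
Unset Printing Implicit Defensive.

Import Order.TTheory GRing.Theory Num.Theory.
Import numFieldNormedType.Exports.

Local Open Scope classical_set_scope.
Local Open Scope ring_scope.

(* Iterated limits along ultrafilters replace Ramsey's theorem on Hamming graphs.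

   Concentration: draw x_1, ..., x_k successively along ultrafilters on a ball of
   X. Since Y is reflexive, f (x_1 + ... + x_k) is the sum of its iterated weak
   limit and of k weakly null increments, which are bounded because f is coarse;
   since Y is asymptotic-c_0, f (x_1 + ... + x_k) stays within a bounded distance
   K, independent of k, of that weak limit. As f is expanding at rate 1, two
   independent sums cannot be at a large distance that is comparable with their
   norms.

   Reflexivity: if F in X** is at distance d > 0 of X, draw the x_i along a bounded
   ultrafilter converging weakly* to F. Two independent sums are then at distance
   at least k d / 2 - 1, for all k: a contradiction.

   Asymptotic-c_0: for weakly null ultrafilters the same argument bounds
   |x_1 + ... + x_k| by a constant A independent of k and of the ultrafilters,
   which may not depend on the earlier x_i. If the vector player wins
   the game on X, her strategy is a tree of weakly null ultrafilters W_s, which do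
   depend on the past. Sum the vertices drawn along W_s over all nodes s of a large
   finite set F, and let F increase along a fine ultrafilter: this gives one weakly
   null ultrafilter V, concentrated on vectors of norm at most A + 1, which contains
   the next vertex of every branch. Apply the bound to V, ..., V and discard the
   vertices off the branch: a convex Lipschitz function is weakly lower
   semicontinuous, so this does not increase the iterated limit. *)

(** * Ultrafilters *)

Section Ultrafilters.

(** The law of a two-stage draw: [x] along [W], then a point along [k x]. Iterating it encodes
    iterated limits. *)
Definition bind (T U : Type) (W : set_system T) (k : T -> set_system U) :
    set_system U :=
  fun A => \forall x \near W, k x A.

Lemma ultraP T (F : set_system T) : ProperFilter F ->
  (forall A, F A \/ F (~` A)) -> UltraFilter F.
Proof.
move=> FF Fdec; split=> // G GG FG; apply/seteqP; split=> // A GA.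
have [//|/FG GnA] := Fdec A.
by have /filter_ex[x []] : G (A `&` ~` A) by exact: filterI.
Qed.

Lemma bind_ultra T U (W : set_system T) (k : T -> set_system U) :
  UltraFilter W -> (forall x, UltraFilter (k x)) -> UltraFilter (bind W k).
Proof.
move=> UW Uk; apply: ultraP; last first.
  move=> A; have [|] := in_ultra_setVsetC [set x | k x A] UW; first by left.
  move=> kA; right; apply: filterS kA => x nkA.
  by have [/nkA|] := in_ultra_setVsetC A (Uk x).
apply: Build_ProperFilter_ex.
    move=> A kA; have [x kxA] := @filter_ex _ W _ [set x | k x A] kA.
    exact: filter_ex kxA.
  split.
  - by rewrite /bind; apply: nearW => x; exact: filterT.
  - by rewrite /bind => A B; apply: filterS2 => x; exact: filterI.
  - by rewrite /bind => A B AB; apply: filterS => x; exact: filterS.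
Qed.

Lemma fmap_ultra T U (f : T -> U) (W : set_system T) :
  UltraFilter W -> UltraFilter (f @ W).
Proof.
by move=> UW; apply: ultraP => A; exact: (in_ultra_setVsetC (f @^-1` A) UW).
Qed.

Lemma ultra_extension I T (B : I -> set T) : inhabited I ->
  (forall i j, exists k, B k `<=` B i `&` B j) -> (forall i, B i !=set0) ->
  exists2 W : set_system T, UltraFilter W & forall i, W (B i).
Proof.
move=> [i0] BI B0.
have FB : Filter (filter_from setT B).
  by apply: filter_fromT_filter => //; exists i0.
have PB : ProperFilter (filter_from setT B) by apply: filter_from_proper.
have [W [UW BW]] := ultraFilterLemma PB.
by exists W => // i; apply: BW; exists i.
Qed.

End Ultrafilters.

(** * Limits of real functions along ultrafilters *)

Section UltraLimits.
Context (R : realType).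

(** [lim] is total; the value is meaningful when [N] is bounded along [W], since a segment is
    compact. *)
Definition ulim T (W : set_system T) (N : T -> R) : R := lim (N @ W).

Definition bounded_along T (W : set_system T) (N : T -> R) :=
  exists M : R, \forall x \near W, `|N x| <= M.

Lemma ulim_cvg T (W : set_system T) (N : T -> R) : UltraFilter W ->
  bounded_along W N -> N @ W --> ulim W N.
Proof.
move=> UW [M NM].
have UNW := fmap_ultra N UW.
have := @segment_compact R (- M) M; rewrite compact_ultra => /(_ (N @ W) UNW).
case=> [|l [_ Nl]]; last by apply/cvg_ex; exists l.
by apply: filterS NM => x /=; rewrite in_itv/= ler_norml.
Qed.

Lemma ulim_near T (W : set_system T) (N : T -> R) e : UltraFilter W ->
  bounded_along W N -> 0 < e -> \forall x \near W, `|N x - ulim W N| <= e.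
Proof.
by move=> UW bN e0; apply: cvgr_distC_le e0; exact: ulim_cvg.
Qed.

Lemma le_ulim T (W : set_system T) (N : T -> R) c : UltraFilter W ->
  bounded_along W N -> (\forall x \near W, c <= N x) -> c <= ulim W N.
Proof. by move=> UW bN cN; apply: limr_ge => //; exact: ulim_cvg. Qed.

Lemma ulim_le T (W : set_system T) (N : T -> R) c : UltraFilter W ->
  bounded_along W N -> (\forall x \near W, N x <= c) -> ulim W N <= c.
Proof. by move=> UW bN cN; apply: limr_le => //; exact: ulim_cvg. Qed.

Lemma ulim_eq T (W : set_system T) (N : T -> R) l : UltraFilter W ->
  N @ W --> l -> ulim W N = l.
Proof. by move=> UW; exact: cvg_lim. Qed.

End UltraLimits.

(** * Convex functions and the Hahn-Banach theorem *)

Section ConvexMinorant.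
Context (R : realType) (V : lmodType R).
Implicit Types (g p : V -> R) (x y a : V) (s t : R).

Definition convex_fun g := forall x y t, 0 <= t <= 1 ->
  g (t *: x + (1 - t) *: y) <= t * g x + (1 - t) * g y.

(** The second hypothesis is joint convexity in the index and the point; it is applied to almost
    minimising indices at [x] and [y]. *)
Lemma convex_fun_inf I (D : set I) (F : I -> V -> R) :
  (forall x, has_inf [set F i x | i in D]) ->
  (forall i j x y t, D i -> D j -> 0 <= t <= 1 -> exists2 k, D k &
    F k (t *: x + (1 - t) *: y) <= t * F i x + (1 - t) * F j y) ->
  convex_fun (fun x => inf [set F i x | i in D]).
Proof.
move=> infF convF x y t t01; apply/ler_addgt0Pr => e e0.
have [_ [i Di <-] Fi] := inf_adherent e0 (infF x).
have [_ [j Dj <-] Fj] := inf_adherent e0 (infF y).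
have [k Dk Fk] := convF i j x y t Di Dj t01.
apply: (@le_trans _ _ (F k (t *: x + (1 - t) *: y))).
  by apply: ge_inf; [case: (infF (t *: x + (1 - t) *: y))|exists k].
apply: (le_trans Fk).
move: Fi Fj t01; set u := inf _; set v := inf _ => Fi Fj /andP[t0 t1].
have := ler_wpM2l t0 (ltW Fi).
have t1' : 0 <= 1 - t by rewrite subr_ge0.
have := ler_wpM2l t1' (ltW Fj).
by rewrite !mulrDr; lra.
Qed.

(** The origin is the convex combination of [t *: a] and [- s *: a] with weights proportional to [s]
    and [t]. *)
Lemma convex_fun_ray g a s t : convex_fun g -> g 0 = 0 -> 0 < s -> 0 < t ->
  0 <= s * g (t *: a) + t * g (- s *: a).
Proof.
move=> cg g0 s0 t0; have st0 : 0 < s + t by rewrite addr_gt0.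
pose u := s / (s + t).
have es : s = (s + t) * u by rewrite mulrC divfK ?gt_eqF.
have et : t = (s + t) * (1 - u) by rewrite mulrBr mulr1 -es addrC addKr.
have u01 : 0 <= u <= 1.
  rewrite /u; apply/andP; split; first by rewrite divr_ge0// ltW.
  by rewrite ler_pdivrMr// mul1r lerDl ltW.
have := cg (t *: a) (- s *: a) _ u01.
rewrite !scalerA -scalerDl (_ : u * t + (1 - u) * - s = 0); last first.
  by rewrite {1}et {2}es; lra.
rewrite scale0r g0 => /(mulr_ge0 (ltW st0)).
by clearbody u; rewrite mulrDr !mulrA -es -et.
Qed.

(** The quotients [g (t *: a) / t] with [t > 0] dominate those with [t < 0], so their infimum is a
    slope on both sides. *)
Lemma line_slope g a : convex_fun g -> g 0 = 0 ->
  exists c : R, forall t, t * c <= g (t *: a).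
Proof.
move=> cg g0; pose E := [set g (t *: a) / t | t in [set t : R | 0 < t]].
have lbE s : 0 < s -> lbound E (- (g (- s *: a) / s)).
  move=> s0 _ [t /= t0 <-]; have := convex_fun_ray a cg g0 s0 t0.
  move=> h; rewrite -subr_ge0 opprK addf_div ?gt_eqF//.
  by rewrite divr_ge0 ?(mulr_ge0 (ltW t0) (ltW s0))//; lra.
have E0 : E !=set0 by exists (g (1 *: a) / 1), 1 => //=; exact: ltr01.
have hE : has_inf E by split => //; exists (- (g (- 1 *: a) / 1)); exact/lbE/ltr01.
exists (inf E) => t; have [t0|t0|->] := ltgtP t 0.
- have t0' : 0 < - t by rewrite oppr_gt0.
  have : - (g (t *: a) / - t) <= inf E.
    by apply: lb_le_inf => //; have := lbE _ t0'; rewrite opprK.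
  by rewrite -mulrN -invrN opprK ler_ndivrMr// mulrC.
- by rewrite mulrC -ler_pdivlMr//; apply: ge_inf; [case: hE|exists t].
- by rewrite mul0r scale0r g0.
Qed.

Let minorant p := [set g | [/\ convex_fun g, g 0 = 0 & forall x, g x <= p x]].

Let minorant_ge p g : minorant p g -> forall x, - p (- x) <= g x.
Proof.
move=> [cg g0 gp] x; have := convex_fun_ray x cg g0 ltr01 ltr01.
by rewrite !mul1r scaleN1r scale1r; have := gp (- x); lra.
Qed.

(** Zorn's lemma for the reversed pointwise order: a nonempty chain is bounded by its pointwise
    infimum, finite because every minorant lies above [- p (- x)]. *)
Let minimal_minorant p : convex_fun p -> p 0 = 0 -> exists2 g, minorant p g &
  forall h, minorant p h -> (forall x, h x <= g x) -> h = g.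
Proof.
move=> cp p0; have pp : minorant p p by [].
pose T := {g | minorant p g}.
pose below (g h : T) := `[< forall x, sval h x <= sval g x >].
have [||||[g mg] ming] := @Zorn T below.
- by move=> g; apply/asboolP.
- move=> g h k /asboolP gh /asboolP hk; apply/asboolP => x.
  exact: le_trans (hk x) (gh x).
- move=> [g mg] [h mh] /asboolP gh /asboolP hg; apply/eq_exist/funext => x.
  by apply/le_anti; rewrite gh hg.
- move=> A totA; have [[g0 Ag0]|A0] := pselect (A !=set0); last first.
    by exists (exist _ p pp) => s As; case: A0; exists s.
  have infA x : has_inf [set sval g x | g in A].
    split; first by exists (sval g0 x), g0.
    by exists (- p (- x)) => _ [g Ag <-]; exact: minorant_ge (svalP g) x.
  pose m x := inf [set sval g x | g in A].
  have m_le (g : T) x : A g -> m x <= sval g x.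
    by move=> Ag; apply: ge_inf; [case: (infA x)|exists g].
  have mm : minorant p m.
    split.
    + apply: convex_fun_inf => // g h x y t Ag Ah /andP[t0 t1].
      have t1' : 0 <= 1 - t by rewrite subr_ge0.
      have [/asboolP le_gh|/asboolP le_gh] := totA _ _ Ag Ah.
      * exists h => //; have [ch _ _] := svalP h.
        apply: (le_trans (ch _ _ _ _)); first by rewrite t0.
        by rewrite lerD2r ler_wpM2l.
      * exists g => //; have [ch _ _] := svalP g.
        apply: (le_trans (ch _ _ _ _)); first by rewrite t0.
        by rewrite lerD2l ler_wpM2l.
    + rewrite /m (_ : [set sval g 0 | g in A] = [set 0]) ?inf1//.
      apply/seteqP; split=> [_ [g Ag <-]|_ ->]; first by have [] := svalP g.
      by exists g0 => //; have [] := svalP g0.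
    + move=> x; apply: (le_trans (m_le g0 x Ag0)).
      by have [_ _] := svalP g0; exact.
  by exists (exist _ m mm) => g Ag; apply/asboolP => x; exact: m_le.
exists g => // h mh le_hg.
suff /(congr1 sval) : exist _ h mh = exist _ g mg :> T by [].
by apply: ming; apply/asboolP.
Qed.

(* A minimal minorant [g] is affine along every line: if [c] is a slope of [g]
   at 0 in the direction [a], then [y |-> inf_t (g (y + t a) - t c)] is again a
   minorant below [g]. *)
Lemma linear_minorant p : convex_fun p -> p 0 = 0 ->
  exists2 phi : V -> R^o, linear phi & forall x, phi x <= p x.
Proof.
move=> cp p0; have [g mg ming] := minimal_minorant cp p0.
have [cg g0 gp] := mg.
suff gline a : exists c, forall t y, g (y + t *: a) = g y + t * c.
  exists g => // k x y; have [c gc] := gline x.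
  have gxE : g x = c by have := gc 1 0; rewrite add0r scale1r mul1r g0 add0r.
  by rewrite [k *: x + y]addrC gc gxE addrC.
have [c gc] := line_slope a cg g0; exists c.
pose F t y := g (y + t *: a) - t * c.
(* The midpoint of [y + t *: a] and [- y] lies on the line spanned by [a], where the slope [c]
   bounds [g] from below. *)
have F_ge y t : - g (- y) <= F t y.
  have := cg (y + t *: a) (- y) (2^-1) _.
  rewrite (_ : 1 - 2^-1 = 2^-1); last lra.
  rewrite -scalerDr addrAC subrr add0r scalerA.
  have := gc (2^-1 * t); rewrite /F.
  set u := g _; set v := g _; set w := g _ => h1 /(_ _)h2.
  have := h2 _; lra.
have infF y : has_inf [set F t y | t in setT].
  by split; [exists (F 0 y), 0|exists (- g (- y)) => _ [t _ <-]].
pose h y := inf [set F t y | t in setT].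
have h_le t y : h y <= F t y.
  by apply: ge_inf; [case: (infF y)|exists t].
have hg y : h y <= g y.
  by apply: (le_trans (h_le 0 y)); rewrite /F scale0r addr0 mul0r subr0.
have mh : minorant p h.
  split.
  - apply: convex_fun_inf => // s t x y u _ _ u01.
    exists (u * s + (1 - u) * t) => //; rewrite /F.
    rewrite (_ : _ + _ *: a = u *: (x + s *: a) + (1 - u) *: (y + t *: a)).
      by have := cg (x + s *: a) (y + t *: a) u u01; lra.
    by rewrite !scalerDr !scalerA addrACA -scalerDl.
  - apply/le_anti; rewrite (le_trans (hg 0)) ?g0//=.
    apply: lb_le_inf; first by exists (F 0 0), 0.
    by move=> _ [t _ <-]; rewrite /F add0r subr_ge0.
  - by move=> x; apply: (le_trans (hg x)).
(* Minimality forces [h = g], which gives one inequality; the other is the same one at [- t] and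
   [y + t *: a]. *)
have gF t y : g y <= F t y by rewrite -(ming _ mh hg).
move=> t y; apply/le_anti/andP; split; last first.
  by have := gF t y; rewrite /F lerBrDr.
have := gF (- t) (y + t *: a); rewrite /F scaleNr addrK; lra.
Qed.

End ConvexMinorant.

(** * Subgradients, separation and weakly null filters in normed spaces *)

Section NormedSpaces.
Context (R : realType) (V : normedModType R).
Implicit Types (H : V -> R) (phi : dual V) (x y z : V) (Z : set V).

Lemma bounded_linear_dual (f : V -> R^o) M : linear f ->
  (forall x, `|f x| <= M * `|x|) -> exists phi : dual V, forall x, phi x = f x.
Proof.
move=> lf fM; have cf : f \in @continuous_linear R V.
  apply/asboolP; split=> //.
  pose F : {linear V -> R^o} := HB.pack f (GRing.isLinear.Build _ _ _ _ _ lf).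
  apply: (@bounded_linear_continuous _ _ _ F); apply/linear_boundedP.
  apply: filterS (nbhs_pinfty_ge (num_real M)) => r Mr x.
  by apply: (le_trans (fM x)); rewrite ler_wpM2r.
by exists (Dual cf).
Qed.

Lemma dual_norm1_le phi x : dual_norm phi <= 1 -> `|phi x| <= `|x|.
Proof.
move=> phi1; apply: (le_trans (le_dual_norm phi x)).
by rewrite -[leRHS]mul1r ler_wpM2r.
Qed.

Definition nonexpansive H := forall x y, H x <= H y + `|x - y|.

(** Take a linear minorant of [y |-> H (x + y) - H x]; it lies below the norm because [H] is
    nonexpansive. *)
Lemma subgradient H x : convex_fun H -> nonexpansive H ->
  exists2 phi : dual V, dual_norm phi <= 1 &
    forall y, H x + phi y <= H (x + y).
Proof.
move=> cH lH; pose p y := H (x + y) - H x.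
have p0 : p 0 = 0 by rewrite /p addr0 subrr.
have cp : convex_fun p.
  move=> u v t t01; rewrite /p.
  rewrite (_ : x + _ = t *: (x + u) + (1 - t) *: (x + v)); last first.
    by rewrite !scalerDr addrACA -scalerDl [t + _]addrC subrK scale1r.
  by have := cH (x + u) (x + v) t t01; lra.
have [f lf fp] := linear_minorant cp p0.
have f_le y : f y <= `|y|.
  apply: (le_trans (fp y)); rewrite lerBlDl; apply: (le_trans (lH _ x)).
  by rewrite addrAC subrr add0r.
have fN y : f (- y) = - f y.
  have f0 : f 0 = 0.
    by have := lf 1 0 0; rewrite scaler0 add0r scale1r => h; lra.
  by have := lf (- 1) y 0; rewrite scaleN1r addr0 f0 addr0 scaleN1r.
have f1 y : `|f y| <= 1 * `|y|.
  rewrite mul1r ler_norml f_le andbT lerNl -fN.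
  by rewrite (le_trans (f_le _))// normrN.
have [phi phiE] := bounded_linear_dual lf f1.
exists phi => [|y].
  by apply: dual_norm_le => y y1; rewrite phiE (le_trans (f1 y))// mul1r.
by rewrite phiE addrC -lerBrDr; exact: fp.
Qed.

Lemma convex_norm : convex_fun (fun x : V => `|x|).
Proof.
move=> x y t /andP[t0 t1]; rewrite (le_trans (ler_normD _ _))// !normrZ.
by rewrite !ger0_norm// subr_ge0.
Qed.

Lemma nonexpansive_norm : nonexpansive (fun x : V => `|x|).
Proof. by move=> x y; rewrite -lerBlDl lerB_dist. Qed.

(** A subgradient of the norm at [x], tested at [- x]. *)
Lemma norming_functional x :
  exists2 phi : dual V, dual_norm phi <= 1 & phi x = `|x|.
Proof.
have [phi phi1 phix] := subgradient x convex_norm nonexpansive_norm.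
exists phi => //; apply/le_anti/andP; split.
  exact: le_trans (ler_norm _) (dual_norm1_le x phi1).
by have := phix (- x); rewrite linearN subrr normr0; lra.
Qed.

Definition subspace Z := Z 0 /\ forall a x y, Z x -> Z y -> Z (a *: x + y).

(** The functional is a subgradient at [x] of the distance to [Z]. *)
Lemma separating_functional Z x d : subspace Z ->
  (forall z, Z z -> d <= `|x - z|) -> exists2 phi : dual V, dual_norm phi <= 1 &
    d <= phi x /\ forall z, Z z -> phi z = 0.
Proof.
move=> [Z0 ZD] dZ.
have infZ y : has_inf [set `|y - z| | z in Z].
  by split; [exists `|y - 0|, 0|exists 0 => _ [z _ <-]].
pose H y := inf [set `|y - z| | z in Z].
have H_le y z : Z z -> H y <= `|y - z|.
  by move=> Zz; apply: ge_inf; [case: (infZ y)|exists z].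
have ZZ a z : Z z -> Z (a *: z) by move=> Zz; rewrite -[_ *: _]addr0; exact: ZD.
have cH : convex_fun H.
  apply: convex_fun_inf => // u v y z t Zu Zv t01.
  exists (t *: u + (1 - t) *: v); first by apply: ZD => //; exact: ZZ.
  rewrite opprD addrACA -!scalerBr; exact: convex_norm.
have lH : nonexpansive H.
  move=> y z; rewrite -lerBlDr; apply: lb_le_inf; first by case: (infZ z).
  move=> _ [u Zu <-]; rewrite lerBlDr; apply: (le_trans (H_le y u Zu)).
  by rewrite (le_trans _ (ler_normD _ _))// [z - u + _]addrC addrA subrK.
have [phi phi1 phix] := subgradient x cH lH; exists phi => //.
have H0 z : Z z -> H z = 0.
  move=> Zz; apply/le_anti; apply/andP; split.
    by apply: (le_trans (H_le z z Zz)); rewrite subrr normr0.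
  by apply: lb_le_inf; [case: (infZ z)|move=> _ [u _ <-]].
have key z : Z z -> H x + phi z <= phi x.
  move=> Zz; have := phix (z - x); rewrite [x + _]addrC subrK (H0 z Zz) linearB/=; lra.
have Hx : d <= H x.
  by apply: lb_le_inf; [case: (infZ x)|move=> _ [z Zz <-]; exact: dZ].
split=> [|z Zz].
  by have := key _ Z0; rewrite linear0 addr0; exact: le_trans.
have [//|phiz] := eqVneq (phi z) 0.
(* On [Z], [phi] is at most [phi x - H x]; this multiple of [z] would exceed that bound by 1. *)
have := key ((phi x - H x + 1) / phi z *: z) (ZZ _ _ Zz).
rewrite linearZ/= -[_ *: phi z]/(_ * _) divfK//; lra.
Qed.

Definition weakly_null (W : set_system V) :=
  forall phi : dual V, phi x @[x --> W] --> (0 : R).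

Lemma weakly_null_le (W : set_system V) phi e : Filter W -> weakly_null W ->
  0 < e -> \forall x \near W, `|phi x| <= e.
Proof. by move=> FW W0; move: e; exact/cvgr0Pnorm_le/W0. Qed.

(** A subgradient at [u] gives an affine minorant of [H] whose linear part tends to 0 along [W]. *)
Lemma weakly_null_lsc (W : set_system V) H u e : Filter W -> weakly_null W ->
  convex_fun H -> nonexpansive H -> 0 < e ->
  \forall y \near W, H u - e <= H (u + y).
Proof.
move=> FW W0 cH lH e0; have [phi phi1 phiu] := subgradient u cH lH.
apply: filterS (weakly_null_le phi FW W0 e0) => y; rewrite ler_norml => /andP[? _].
by have := phiu y; lra.
Qed.

(* [Z] is not assumed closed, so that the induction can add to [Z] the line
   spanned by one of the [b i]. *)
Lemma weakly_null_finite_codim (W : set_system V) k Z (b : 'I_k -> V) e :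
  Filter W -> weakly_null W -> subspace Z ->
  (forall x, exists c : 'I_k -> R, Z (x - \sum_(i < k) c i *: b i)) -> 0 < e ->
  \forall x \near W, exists2 z, Z z & `|x - z| <= e.
Proof.
move=> FW W0; elim: k Z b e => [|k IH] Z b e [Z0 ZD] bZ e0.
  apply: nearW => x; exists x; last by rewrite subrr normr0 ltW.
  by have [c] := bZ x; rewrite big_ord0 subr0.
pose Z' := [set x | exists c, Z (x - c *: b ord0)].
have IHZ' e' : 0 < e' -> \forall x \near W, exists2 z, Z' z & `|x - z| <= e'.
  apply: (IH _ (fun i => b (lift ord0 i))).
    split=> [|a x y [c Zx] [c' Zy]]; first by exists 0; rewrite scale0r subr0.
    exists (a * c + c'); rewrite scalerDl opprD addrACA -scalerA -scalerBr.
    exact: ZD.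
  move=> x; have [c Zx] := bZ x; exists (fun i => c (lift ord0 i)), (c ord0).
  by move: Zx; rewrite big_ord_recl [c ord0 *: _ + _]addrC opprD addrA.
(* If [b ord0] is in the closure of [Z], its multiples are approximated by elements of [Z]. *)
have [b0Z|] := pselect (forall d, 0 < d -> exists2 z, Z z & `|b ord0 - z| <= d).
  apply: filterS (IHZ' (e / 2) _); last by rewrite divr_gt0.
  move=> x [z [c Zz] xz]; have c0 : 0 < `|c| + 1 by rewrite ltr_wpDl.
  have [|z' Zz' bz'] := b0Z (e / 2 / (`|c| + 1)); first by rewrite !divr_gt0.
  exists (c *: z' + (z - c *: b ord0)); first exact: ZD.
  rewrite (_ : x - _ = (x - z) + c *: (b ord0 - z')); last first.
    rewrite scalerBr opprD opprB -[RHS]addrA; congr (_ + _).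
    by rewrite addrC -addrA addrCA.
  rewrite (le_trans (ler_normD _ _))// normrZ [leRHS]splitr lerD//.
  rewrite (le_trans (ler_wpM2l _ bz'))// mulrCA ger_pMr ?divr_gt0//.
  by rewrite ler_pdivrMr// mul1r lerDl.
move=> /existsNP[d /not_implyP[d0 b0Z]].
have {}b0Z z : Z z -> d <= `|b ord0 - z|.
  by move=> Zz; rewrite leNgt; apply/negP => /ltW ?; apply: b0Z; exists z.
(* Otherwise a functional vanishing on [Z] but not at [b ord0] shows that the coefficient [c] is
   small along [W]; [q] is chosen so that the two errors add up to [e]. *)
have [phi phi1 [phib phiZ]] := separating_functional (conj Z0 ZD) b0Z.
pose q := 1 + 2 / d * `|b ord0|.
have q0 : 0 < q by rewrite ltr_pwDl// mulr_ge0// divr_ge0// ltW.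
have eq0 : 0 < e / q by rewrite divr_gt0.
apply: filterS2 (IHZ' _ eq0) (weakly_null_le phi FW W0 eq0) => x [z [c Zz] xz] phix.
exists (z - c *: b ord0) => //.
have phizE : phi z = c * phi (b ord0).
  by have := phiZ _ Zz; rewrite linearB linearZ/= => /eqP; rewrite subr_eq0 => /eqP.
have cd : `|c| <= 2 / d * (e / q).
  rewrite mulrAC ler_pdivlMr//.
  have := dual_norm1_le (x - z) phi1; rewrite linearB/= phizE => h.
  have : `|c * phi (b ord0)| <= 2 * (e / q).
    have := ler_normB (phi x) (phi x - c * phi (b ord0)).
    rewrite opprB addrC subrK => h'; apply: (le_trans h'); rewrite mulr_natl mulr2n.
    exact: lerD phix (le_trans h xz).
  rewrite normrM; apply: le_trans; rewrite ler_wpM2l//.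
  exact: le_trans phib (ler_norm _).
rewrite opprB addrCA addrC (le_trans (ler_normD _ _))// normrZ.
apply: (@le_trans _ _ (e / q + 2 / d * (e / q) * `|b ord0|)).
  by rewrite lerD// ler_wpM2r.
rewrite mulrAC -[e / q in X in X + _]mul1r -mulrDl -/q mulrC divfK//.
by rewrite gt_eqF.
Qed.

End NormedSpaces.

(** * Weak limits *)

Section WeakLimits.
Context (R : realType).

(** The limits of [phi (h t)] are linear and bounded in [phi]: they form an element of the bidual,
    which reflexivity represents by a vector. *)
Lemma weak_limit (Y : normedModType R) T (W : set_system T) (h : T -> Y) M :
  reflexive_space Y -> UltraFilter W -> (\forall t \near W, `|h t| <= M) ->
  exists y, forall phi : dual Y, phi (h t) @[t --> W] --> (phi y : R).
Proof.
move=> reflY UW hM.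
have bW (phi : dual Y) :
    \forall t \near W, `|phi (h t)| <= `|M| * `|phi|.
  apply: filterS hM => t ht; rewrite (le_trans (le_dual_norm _ _))// mulrC.
  by rewrite ler_wpM2r ?dual_norm_ge0// (le_trans ht)// ler_norm.
have cvgF (phi : dual Y) :
    phi (h t) @[t --> W] --> ulim W (fun t => phi (h t) : R).
  by apply: ulim_cvg; exists (`|M| * `|phi|); exact: bW.
pose F (phi : dual Y) : R^o := ulim W (fun t => phi (h t) : R).
have lF : linear F.
  move=> a f g.
  apply: (@ulim_eq R T W (fun t => a * (f (h t) : R) + (g (h t) : R)) _ UW).
  by apply: cvgD; [apply: cvgZl_tmp|]; exact: cvgF.
have FM (phi : dual Y) : `|F phi| <= `|M| * `|phi|.
  rewrite ler_norml; apply/andP; split.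
    apply: le_ulim; first by exists (`|M| * `|phi|); exact: bW.
    by apply: filterS (bW phi) => t; rewrite ler_norml => /andP[].
  apply: ulim_le; first by exists (`|M| * `|phi|); exact: bW.
  by apply: filterS (bW phi) => t; rewrite ler_norml => /andP[].
have [Phi PhiE] := bounded_linear_dual lF FM.
have [y yPhi] := reflY Phi; exists y => phi.
rewrite (_ : phi y = F phi); first exact: cvgF.
by rewrite -PhiE -yPhi.
Qed.

(** Weak lower semicontinuity of the norm, read off a functional norming [y - v]. *)
Lemma weak_limit_dist (Y : normedModType R) T (W : set_system T) (h : T -> Y)
    y v D : ProperFilter W ->
  (forall phi : dual Y, phi (h t) @[t --> W] --> (phi y : R)) ->
  (\forall t \near W, `|h t - v| <= D) -> `|y - v| <= D.
Proof.
move=> FW hy hD; have [phi phi1 phiE] := norming_functional (y - v).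
rewrite -phiE linearB/= lerBlDr; apply: (cvgr_to_le (hy phi)).
apply: filterS hD => t htv; rewrite -lerBlDr.
have := dual_norm1_le (h t - v) phi1; rewrite linearB/= => phitv.
exact: le_trans (ler_norm _) (le_trans phitv htv).
Qed.

Context (V : normedModType R).

(* Let [x] almost minimise the sum over the ball of radius [r], and let [Psi] be
   the first variation of the sum at [x]. Then [Psi] is almost minimal at [x],
   hence [r * dual_norm Psi] is at most about [- Psi x], whereas [F Psi] is
   [Psi x] minus the sum. *)
Let goldstine_approx (F : dual (dual V)) r (l : seq (dual V)) d :
  0 < r -> dual_norm F <= r -> 0 < d ->
  exists2 x, `|x| <= r & \sum_(phi <- l) (phi x - F phi) ^+ 2 <= d.
Proof.
move=> r0 Fr d0; pose q x := \sum_(phi <- l) (phi x - F phi : R) ^+ 2.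
have q_ge0 x : 0 <= q x by apply: sumr_ge0 => phi _; exact: sqr_ge0.
pose M := \sum_(phi <- l) (dual_norm phi * (r + r)) ^+ 2.
have M0 : 0 <= M by apply: sumr_ge0 => phi _; exact: sqr_ge0.
pose E := [set q x | x in [set x : V | `|x| <= r]].
have infE : has_inf E.
  split; first by exists (q 0), 0; rewrite //= normr0 ltW.
  by exists 0 => _ [x _ <-].
have D0 : 0 < 1 + M + d by rewrite ltr_wpDl// addr_ge0.
(* Step length from [x] towards [y]: [t <= 1] keeps the new point in the ball, and
   [t * (1 + M) <= d] absorbs the tolerance [t ^+ 2] and the second-order term. *)
pose t := d / (1 + M + d).
have t0 : 0 < t by rewrite divr_gt0.
have t1 : t <= 1 by rewrite ler_pdivrMr// mul1r lerDr addr_ge0.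
have tM : t * (1 + M) <= d.
  by rewrite mulrAC ler_pdivrMr// ler_wpM2l ?(ltW d0)// lerDl ltW.
clearbody t.
have [_ [x xr <-] qx] := inf_adherent (exprn_gt0 2 t0) infE.
exists x => //; change (q x <= d).
pose Psi : dual V := \sum_(phi <- l) (phi x - F phi) *: phi.
have PsiE y : Psi y = \sum_(phi <- l) (phi x - F phi) * phi y.
  rewrite -[Psi y]/(bidual_embedding y Psi) linear_sum.
  by apply: eq_bigr => phi _; rewrite linearZ.
have FPsi : F Psi = Psi x - q x.
  rewrite PsiE linear_sum/= -sumrB; apply: eq_bigr => phi _.
  by rewrite linearZ/= -[_ *: F phi]/(_ * F phi); lra.
have Psi_ge y : `|y| <= r -> Psi x - d / 2 <= Psi y.
  move=> yr; have : inf E <= q (x + t *: (y - x)).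
    apply: ge_inf; first by case: infE.
    exists (x + t *: (y - x)) => //=.
    rewrite (_ : x + _ = t *: y + (1 - t) *: x); last first.
      by rewrite scalerBr scalerBl scale1r addrCA.
    have t01 : 0 <= t <= 1 by rewrite ltW.
    apply: (le_trans (convex_norm y x t01)).
    have := ler_wpM2l (ltW t0) yr.
    have t1' : 0 <= 1 - t by rewrite subr_ge0.
    have := ler_wpM2l t1' xr; lra.
  have -> : q (x + t *: (y - x)) = q x + 2 * t * (Psi y - Psi x) +
      t ^+ 2 * \sum_(phi <- l) (phi y - phi x) ^+ 2.
    rewrite !PsiE -sumrB !mulr_sumr -!big_split; apply: eq_bigr => phi _ /=.
    by rewrite linearD linearZ/= linearB/= -[t *: _]/(t * _); lra.
  have SM : \sum_(phi <- l) (phi y - phi x) ^+ 2 <= M.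
    apply: ler_sum => phi _; rewrite -linearB -real_normK ?num_real//.
    rewrite lerXn2r ?nnegrE ?mulr_ge0 ?addr_ge0 ?dual_norm_ge0 ?(ltW r0)//.
    rewrite (le_trans (le_dual_norm _ _))// ler_wpM2l ?dual_norm_ge0//.
    by rewrite (le_trans (ler_normB _ _))// lerD.
  have := ler_wpM2l (sqr_ge0 t) SM; set S := \sum_(_ <- _) _.
  move=> tS h; suff : 0 <= t * (t * (1 + M) + 2 * (Psi y - Psi x)).
    by rewrite pmulr_rge0//; lra.
  lra.
have nPsi : dual_norm Psi <= (d / 2 - Psi x) / r.
  apply: dual_norm_le => y y1; rewrite ler_pdivlMr// mulrC.
  have ry : `|r *: y| <= r by rewrite normrZ gtr0_norm// ger_pMr.
  have := Psi_ge _ ry; have := Psi_ge (- (r *: y)).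
  have rPsi : Psi (r *: y) = r * Psi y by rewrite linearZ.
  rewrite normrN => /(_ ry); rewrite [Psi (- _)]linearN rPsi.
  have [?|?] := lerP 0 (Psi y); [rewrite ger0_norm//|rewrite ltr0_norm//]; lra.
have : - (r * dual_norm Psi) <= F Psi.
  have := le_dual_norm F Psi; rewrite ler_norml => /andP[+ _].
  by apply: le_trans; rewrite lerN2 ler_wpM2r ?dual_norm_ge0.
move: nPsi; rewrite ler_pdivlMr// [_ * r]mulrC FPsi; lra.
Qed.

Lemma goldstine (F : dual (dual V)) r : 0 < r -> dual_norm F <= r ->
  exists W : set_system V, [/\ UltraFilter W, \forall x \near W, `|x| <= r &
    forall phi : dual V, phi x @[x --> W] --> (F phi : R)].
Proof.
(* The fixed tolerance 1 suffices, since [l] may contain large multiples of a functional. *)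
move=> r0 Fr; pose B (l : seq (dual V)) :=
  [set x : V | `|x| <= r /\ forall phi, phi \in l -> `|phi x - F phi| <= 1].
have [|l l'|l|W UW BW] := @ultra_extension _ _ B.
- exact: (inhabits [::]).
- exists (l ++ l') => x [xr xl]; split; split=> // phi phil; apply: xl.
    by rewrite mem_cat phil.
  by rewrite mem_cat phil orbT.
- have [x xr xl] := goldstine_approx l r0 Fr ltr01.
  exists x; split=> // phi phil.
  rewrite -(@ler_pXn2r _ 2)// ?nnegrE// expr1n real_normK ?num_real//.
  apply: le_trans xl; rewrite (big_rem phi phil)/= lerDl.
  by apply: sumr_ge0 => psi _; exact: sqr_ge0.
exists W; split=> // [|phi]; first by apply: filterS (BW [::]) => x [].
apply/cvgrPdistC_le => e e0; apply: filterS (BW [:: e^-1 *: phi]) => x [_].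
move=> /(_ _ (mem_head _ _)); rewrite linearZ dual_scaleE -scalerBr normrZ.
by rewrite gtr0_norm ?invr_gt0// ler_pdivrMl// mulr1.
Qed.

Definition weakly_null_ultra r (W : set_system V) :=
  [/\ UltraFilter W, \forall x \near W, `|x| <= r & weakly_null W].

Lemma cof_subspace Z : cof Z -> @subspace R V Z.
Proof.
move=> [[Z0 ZD] _ _]; split=> [|a x y /mem_set Zx /mem_set Zy].
  exact: (set_mem Z0).
exact: set_mem (ZD a x y Zx Zy).
Qed.

Lemma cofT : @cof R V setT.
Proof.
split; [|exact: closedT|by exists 0%N, (fun=> 0) => x; exists (fun=> 0)].
by split=> [|a x y _ _]; exact: mem_set.
Qed.

(** If [phi] does not vanish on [Z], a vector [z] of [Z] with [phi z != 0] joins the spanning family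
    to correct the value of [phi]. *)
Lemma cof_setI_ker (phi : dual V) Z : cof Z -> cof (Z `&` [set x | phi x = 0]).
Proof.
move=> cofZ; have [Z0 ZD] := cof_subspace cofZ.
have [_ clZ [k [b bZ]]] := cofZ; split.
- split=> [|a x y /set_mem[Zx /= phix] /set_mem[Zy /= phiy]]; apply: mem_set.
    by split=> //=; exact: linear0.
  split=> /=; first exact: ZD.
  by rewrite linearP/= phix phiy scaler0 addr0.
- apply: closedI => //; rewrite (_ : mkset _ = phi @^-1` [set 0])//.
  by apply: closed_comp => [x _|]; [exact: dual_continuous|exact: closed_eq].
- have [[z [Zz phiz]]|phiZ] := pselect (exists z, Z z /\ phi z != 0); last first.
    exists k, b => x; have [c Zx] := bZ x; exists c; split=> //=.
    by apply/eqP; apply: contrapT => /negP phix; apply: phiZ; eexists; eauto.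
  exists k.+1, (fun i => if unlift ord0 i is Some j then b j else z) => x.
  have [c Zx] := bZ x; set x' := x - _ in Zx.
  exists (fun i => if unlift ord0 i is Some j then c j else phi x' / phi z).
  rewrite big_ord_recl unlift_none; under eq_bigr do rewrite liftK.
  rewrite [_ *: z + _]addrC opprD addrA -/x' -scaleNr addrC; split=> /=.
    exact: ZD.
  rewrite linearD linearZ/= scaleNr -[_ *: phi z]/(_ * phi z) divfK//.
  by rewrite addrC subrr.
Qed.

Lemma cof_kernels (l : seq (dual V)) :
  cof [set x : V | forall phi, phi \in l -> phi x = 0].
Proof.
elim: l => [|phi l IH].
  by rewrite (_ : mkset _ = setT); [exact: cofT|apply/seteqP; split].
rewrite (_ : mkset _ = [set x | forall psi, psi \in l -> psi x = 0] `&`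
    [set x | phi x = 0]); first exact: cof_setI_ker.
apply/seteqP; split=> [x xl|x [xl phix] psi].
  by split=> [psi psil|]; apply: xl; rewrite inE ?psil ?orbT ?eqxx.
by rewrite inE => /orP[/eqP->//|]; exact: xl.
Qed.

(** Finitely many kernels meet in a member of [cof], so the points of [S] there form a filter base;
    along an ultrafilter refining it, each functional is eventually 0. *)
Lemma cof_weakly_null_ultra (S : set V) :
  (forall Z, cof Z -> exists x, [/\ Z x, `|x| <= 1 & S x]) ->
  exists2 W, weakly_null_ultra 1 W & W S.
Proof.
move=> cofS; pose B (l : seq (dual V)) :=
  [set x : V | [/\ S x, `|x| <= 1 & forall phi, phi \in l -> phi x = 0]].
have [|l l'|l|W UW BW] := @ultra_extension _ _ B.
- exact: (inhabits [::]).
- exists (l ++ l') => x [Sx x1 xl].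
  by split; split=> // phi phil; apply: xl; rewrite mem_cat phil ?orbT.
- by have [x [xl x1 Sx]] := cofS _ (cof_kernels l); exists x.
exists W; last by apply: filterS (BW [::]) => x [].
split=> // [|phi]; first by apply: filterS (BW [::]) => x [].
apply/cvgr0Pnorm_le => e e0; apply: filterS (BW [:: phi]) => x [_ _].
by move=> /(_ _ (mem_head _ _)) ->; rewrite normr0 ltW.
Qed.

End WeakLimits.

(** * Concentration *)

Section Convolution.
Context (R : realType) (V : normedModType R).
Implicit Types (l : seq (set_system V)) (u : V).

(* The law of [u + x_1 + ... + x_k], where [x_1, ..., x_k] are drawn successively
   along the ultrafilters of [l]. *)
Fixpoint conv l u : set_system V :=
  if l is W :: l' then bind W (fun x => conv l' (u + x)) else principal_filter u.

Lemma conv_ultra l u :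
  (forall W, W \in l -> UltraFilter W) -> UltraFilter (conv l u).
Proof.
elim: l u => [|W l IH] u Ul /=; first exact: principal_filter_ultra.
apply: bind_ultra => [|x]; first by apply: Ul; rewrite mem_head.
by apply: IH => W' lW'; apply: Ul; rewrite inE lW' orbT.
Qed.

Lemma conv_bounded l u r :
  (forall W, W \in l -> UltraFilter W /\ \forall x \near W, `|x| <= r) ->
  \forall z \near conv l u, `|z - u| <= (size l)%:R * r.
Proof.
elim: l u => [|W l IH] u Ul /=.
  by apply/principal_filterP; rewrite subrr normr0 mul0r.
have [UW Wr] := Ul _ (mem_head _ _).
have {}Ul W' : W' \in l -> UltraFilter W' /\ \forall x \near W', `|x| <= r.
  by move=> lW'; apply: Ul; rewrite inE lW' orbT.
apply: (@filterS _ W _ _ _ _ Wr) => x xr.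
have Ux : UltraFilter (conv l (u + x)) by apply: conv_ultra => W' /Ul[].
apply: (@filterS _ (conv l (u + x)) _ _ _ _ (IH _ Ul)) => z zux.
rewrite -[(size l).+1%:R]natr1 mulrDl mul1r (_ : z - u = (z - (u + x)) + x); last first.
  by rewrite opprD addrA subrK.
exact: le_trans (ler_normD _ _) (lerD zux xr).
Qed.

Lemma bounded_along_conv_norm l r :
  (forall W, W \in l -> UltraFilter W /\ \forall x \near W, `|x| <= r) ->
  bounded_along (conv l 0) (fun z => `|z|).
Proof.
move=> lr; have UU : UltraFilter (conv l 0) by apply: conv_ultra => W /lr[].
exists ((size l)%:R * r); apply: filterS (conv_bounded 0 lr) => z.
by rewrite subr0 normr_id.
Qed.

Lemma conv_cvg l u (phi : dual V) (c : R) :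
  (forall W, W \in l -> UltraFilter W /\ phi x @[x --> W] --> c) ->
  phi z @[z --> conv l u] --> (phi u + (size l)%:R * c : R).
Proof.
move=> Ul; have UU : UltraFilter (conv l u) by apply: conv_ultra => W /Ul[].
apply/cvgrPdistC_le; elim: l u Ul UU => [|W l IH] u Ul _ e e0 /=.
  by apply/principal_filterP; rewrite mul0r addr0 subrr normr0 ltW.
have [UW Wc] := Ul _ (mem_head _ _).
have {}Ul W' : W' \in l -> UltraFilter W' /\ phi x @[x --> W'] --> c.
  by move=> lW'; apply: Ul; rewrite inE lW' orbT.
have e20 : 0 < e / 2 by rewrite divr_gt0.
have /cvgrPdistC_le/(_ _ e20) := Wc.
apply: (@filterS _ W) => x xc.
have Ux : UltraFilter (conv l (u + x)) by apply: conv_ultra => W' /Ul[].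
apply: (@filterS _ (conv l (u + x)) _ _ _ _ (IH _ Ul Ux _ e20)) => z.
have uxE : phi (u + x) = phi u + phi x by rewrite linearD.
have nE : (size l).+1%:R = (size l)%:R + 1 :> R by rewrite natr1.
move: xc; rewrite uxE nE !ler_norml => /andP[? ?] /andP[? ?].
apply/andP; split; lra.
Qed.

End Convolution.

Section Concentration.
Context (R : realType) (X : normedModType R) (Y : normedModType R).
Variable f : X -> Y.

(* [h] is the iterated weak limit of [f] along [l]. Along a branch [f - h] is
   the sum of the increments of the successive weak limits, which are weakly null
   and of norm at most [D], hence close to answers to the strategy given by the
   game on [Y]. *)
Lemma concentration_game (l : seq (set_system X)) r D e :
  reflexive_space Y -> 0 <= D -> 0 < e ->
  (forall W, W \in l -> UltraFilter W /\ \forall x \near W, `|x| <= r) ->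
  (forall u v, `|u - v| <= r + r -> `|f u - f v| <= D) ->
  exists2 h : X -> Y, forall u v, `|u - v| <= r + r -> `|h u - h v| <= D &
    forall u s P, cof_game (size l) P s -> \forall z \near conv l u,
      exists ys, [/\ size ys = size l, P (s ++ ys) &
        `|f z - h u - (D + e) *: \sum_(y <- ys) y| <= (size l)%:R * e].
Proof.
move=> reflY D0 e0 + fD; have De0 : 0 < D + e by rewrite ltr_wpDl.
elim: l => [|W l IH] Ul.
  exists f => // u s P Ps /=; apply/principal_filterP; exists [::].
  by rewrite cats0 big_nil scaler0 subrr subr0 normr0 mul0r.
have [UW Wr] := Ul _ (mem_head _ _).
have {}Ul W' : W' \in l -> UltraFilter W' /\ \forall x \near W', `|x| <= r.
  by move=> lW'; apply: Ul; rewrite inE lW' orbT.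
have [h' h'D gameh'] := IH Ul.
have near_close u x : `|x| <= r ->
    \forall x' \near W, `|h' (u + x') - h' (u + x)| <= D.
  move=> xr; apply: filterS Wr => x' x'r; apply: h'D.
  by rewrite opprD addrACA subrr add0r (le_trans (ler_normB _ _))// lerD.
have hu u : exists y, forall phi : dual Y,
    phi (h' (u + x)) @[x --> W] --> (phi y : R).
  have [x xr] := filter_ex Wr.
  apply: (@weak_limit _ _ _ _ _ (`|h' (u + x)| + D)) => //.
  apply: filterS (near_close u x xr) => x' x'D.
  by rewrite -lerBlDl (le_trans (lerB_dist _ _)).
have [h hP] := choice hu; exists h => [u v uv|u s P /= [Z cofZ gameZ]].
  rewrite -[h u - h v]subr0.
  apply: (@weak_limit_dist _ _ _ W (fun x => h' (u + x) - h' (v + x))).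
    move=> phi; rewrite linearB/=.
    under eq_fun do rewrite linearB/=.
    exact: cvgB.
  apply: nearW => x; rewrite subr0; apply: h'D.
  by rewrite opprD addrACA subrr addr0.
pose d x := h' (u + x) - h u.
have dD x : `|x| <= r -> `|d x| <= D.
  move=> xr; rewrite /d distrC.
  exact: weak_limit_dist (hP u) (near_close u x xr).
have d0 : weakly_null (d @ W).
  move=> phi; rewrite /d.
  suff : phi (d x) @[x --> W] --> (phi (h u) - phi (h u) : R) by rewrite subrr.
  rewrite /d; under eq_fun do rewrite linearB/=.
  by apply: cvgB; [exact: hP|exact: cvg_cst].
have [_ _ [k [b bZ]]] := cofZ.
have dZ : \forall x \near W, exists2 z, Z z & `|d x - z| <= e.
  exact: weakly_null_finite_codim _ d0 (cof_subspace cofZ) bZ e0.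
apply: (@filterS2 _ W _ _ _ _ _ Wr dZ) => x xr [z Zz dxz].
(* The increment is within [e] of [z], so dividing [z] by [D + e] gives a legal move of the game. *)
have zD : `|z| <= D + e.
  rewrite -(subrK (d x) z) addrC (le_trans (ler_normD _ _))// lerD ?dD//.
  by rewrite distrC.
have gamex : cof_game (size l) P (rcons s ((D + e)^-1 *: z)).
  have [Z0 ZD] := cof_subspace cofZ.
  apply: gameZ; first by rewrite -[_ *: z]addr0; exact: ZD.
  by rewrite normrZ gtr0_norm ?invr_gt0// ler_pdivrMl// mulr1.
have Ux : UltraFilter (conv l (u + x)) by apply: conv_ultra => W' /Ul[].
apply: (@filterS _ (conv l (u + x)) _ _ _ _ (gameh' (u + x) _ _ gamex)).
move=> w [ys [sys Pys wys]]; exists ((D + e)^-1 *: z :: ys); split.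
- by rewrite /= sys.
- by rewrite -cat_rcons.
rewrite big_cons scalerDr scalerA divff ?gt_eqF// scale1r.
rewrite (_ : _ - _ = (f w - h' (u + x) - (D + e) *: \sum_(y <- ys) y) + (d x - z)).
  rewrite -[(size l).+1%:R]natr1 mulrDl mul1r.
  exact: le_trans (ler_normD _ _) (lerD wys dxz).
rewrite /d [RHS]addrACA opprD [- _ - _]addrC; congr (_ + _).
by rewrite addrA subrK.
Qed.

Lemma concentration r : reflexive_space Y -> asymptotic_c0 Y -> coarse f ->
  0 <= r -> exists K : R, forall l : seq (set_system X),
  (forall W, W \in l -> UltraFilter W /\ \forall x \near W, `|x| <= r) ->
  exists v, \forall z \near conv l 0, `|f z - v| <= K.
Proof.
move=> reflY [C C1 gameY] cf r0.
have [D [D0 fD]] : exists D : R, 0 <= D /\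
    forall u v, `|u - v| <= r + r -> `|f u - f v| <= D.
  have := cf (r + r) (addr_ge0 r0 r0); set E := expansion_modulus _ _ => Efin.
  have fE u v : `|u - v| <= r + r -> (`|f u - f v|%:E <= E)%E.
    by move=> uv; apply: ereal_sup_ubound; exists (u, v).
  have E0 : (0 <= E)%E.
    by apply: le_trans (fE 0 0 _); rewrite ?lee_fin// subrr normr0 addr_ge0.
  have Efin' : E \is a fin_num by rewrite ge0_fin_numE.
  exists (fine E); split; first exact: fine_ge0.
  by move=> u v /fE; rewrite -[X in (_ <= X)%E](fineK Efin') lee_fin.
(* One error [e] accrues per draw; this choice keeps their sum below 1, so that the bound is
   independent of [l]. *)
exists ((D + 1) * C + 1) => l Ul; pose e : R := (size l).+1%:R^-1.
have e0 : 0 < e by rewrite invr_gt0.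
have e1 : e <= 1 by rewrite invf_le1// ler1n.
have le1 : (size l)%:R * e <= 1 by rewrite ler_pdivrMr// mul1r ler_nat.
have [h _ gameh] := concentration_game reflY D0 e0 Ul fD.
exists (h 0).
have Ux : UltraFilter (conv l 0) by apply: conv_ultra => W' /Ul[].
apply: (@filterS _ (conv l 0) _ _ _ _ (gameh 0 _ _ (gameY (size l)))).
move=> z [ys [sys Pys zys]].
have ysC : `|\sum_(y <- ys) y| <= C.
  have := Pys (fun=> 1); rewrite cat0s.
  under eq_bigr do rewrite scale1r.
  rewrite (big_nth 0) big_mkord sys => /le_trans; apply.
  rewrite -[leRHS]mulr1 ler_wpM2l//; first exact: le_trans ler01 C1.
  apply: (big_ind (fun x : R => x <= 1)) => // [x y|i _]; last by rewrite normr1.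
  by rewrite ge_max => -> ->.
rewrite -(subrK ((D + e) *: \sum_(y <- ys) y) (f z - h 0)) addrC.
rewrite (le_trans (ler_normD _ _))// lerD//; last exact: le_trans zys le1.
have De0 : 0 <= D + e by rewrite addr_ge0// ltW.
by rewrite normrZ ger0_norm// ler_pM// lerD2l.
Qed.

End Concentration.

(** * Maps expanding at rate 1 *)

Section Expanding.
Context (R : realType) (X Y : completeNormedModType R).
Variable f : X -> Y.
Hypotheses (reflY : reflexive_space Y) (c0Y : asymptotic_c0 Y).
Hypotheses (cf : coarse f) (ef : expanding_at_rate1 f).

Lemma expanding_escape L K : 0 < L -> exists T : R, forall x z,
  T < `|x - z| -> L * Num.max `|x| `|z| + L <= `|x - z| -> K < `|f x - f z|.
Proof.
move=> L0; have [rho [_ rhoy rhof]] := ef L0.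
have [T [_ TK]] := (cvgryPgt _).1 rhoy K.
exists T => x z Txz Lxz; exact: lt_le_trans (TK _ Txz) (rhof x z Lxz).
Qed.

(** Two independent sums have norms near the iterated limit [s], and a functional norming the first
    is small on the second, so their distance is at least about [s]. *)
Lemma weakly_null_conv_bound r : 0 <= r -> exists2 A : R, 0 <= A &
  forall l, (forall W, W \in l -> weakly_null_ultra r W) ->
  ulim (conv l (0 : X)) (fun z => `|z|) <= A.
Proof.
move=> r0; have [K fK] := concentration reflY c0Y cf r0.
have L0 : 0 < 4^-1 :> R by rewrite invr_gt0.
have [T fT] := expanding_escape (K + K) L0.
(* With [L = 1/4], [s > 4] yields [L * (s + 1) + L <= s - 2], and [s > T + 2] puts the distance
   above [T]. *)
exists (Num.max 4 (T + 2)) => [|l Ul]; first by rewrite le_max ler0n.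
have [|v fv] := fK l; first by move=> W /Ul[].
have UU : UltraFilter (conv l (0 : X)) by apply: conv_ultra => W /Ul[].
have bU : bounded_along (conv l (0 : X)) (fun z => `|z|).
  by apply: (@bounded_along_conv_norm _ _ l r) => W /Ul[].
have := ulim_near UU bU ltr01; set s := ulim _ _ => zs.
have [x [fx xs]] := filter_ex (filterI fv zs).
have [phi phi1 phix] := norming_functional x.
have phi0 : weakly_null (conv l (0 : X)).
  move=> psi; have := @conv_cvg _ _ l 0 psi 0.
  by rewrite linear0 mulr0 addr0; apply => W /Ul[].
have phi_le : \forall z \near conv l (0 : X), `|phi z| <= 1.
  exact: weakly_null_le.
have [z [[fz zs'] phiz]] := filter_ex (filterI (filterI fv zs) phi_le).
rewrite leNgt; apply/negP; rewrite gt_max => /andP[s4 sT].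
have xz : s - 2 <= `|x - z|.
  have := dual_norm1_le (x - z) phi1; rewrite linearB/= phix.
  move: xs phiz; rewrite !ler_norml => /andP[? ?] /andP[? ?] /andP[? ?]; lra.
have := fT x z; have -> : T < `|x - z| by lra.
have -> : 4^-1 * Num.max `|x| `|z| + 4^-1 <= `|x - z|.
  have : Num.max `|x| `|z| <= s + 1.
    move: xs zs'; rewrite ge_max !ler_norml => /andP[? ?] /andP[? ?].
    apply/andP; split; lra.
  lra.
move=> /(_ isT isT); apply/negP; rewrite -leNgt.
rewrite (_ : f x - f z = (f x - v) - (f z - v)); last first.
  by rewrite opprB addrA subrK.
exact: le_trans (ler_normB _ _) (lerD fx fz).
Qed.

(** The embedding is isometric and [X] is complete, so approximations of [F] within [1 / n.+1] form
    a convergent sequence. *)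
Lemma bidual_closed (F : dual (dual X)) :
  (forall d, 0 < d -> exists x : X, dual_norm (F - bidual_embedding x) < d) ->
  exists x : X, bidual_embedding x = F.
Proof.
move=> Fx.
have /choice[u uF] : forall n, exists x : X,
    dual_norm (F - bidual_embedding x) < n.+1%:R^-1.
  by move=> n; apply: Fx; rewrite invr_gt0.
have uuF (x y : X) : `|x - y| <=
    dual_norm (F - bidual_embedding x) + dual_norm (F - bidual_embedding y).
  have [phi phi1 <-] := norming_functional (x - y).
  have FJ w : `|F phi - phi w| <= dual_norm (F - bidual_embedding w).
    have : `|F phi - phi w| <= dual_norm (F - bidual_embedding w) * `|phi|.
      exact: (le_dual_norm (F - bidual_embedding w) phi).
    by move/le_trans; apply; rewrite ler_piMr// dual_norm_ge0.
  have := FJ x; have := FJ y; rewrite linearB/= !ler_norml.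
  by move=> /andP[? ?] /andP[? ?]; lra.
have inv_small e : 0 < e -> \forall n \near \oo, n.+1%:R^-1 <= e :> R.
  by move=> e0; apply: filterS (near_infty_natSinv_lt (PosNum e0)) => n /ltW.
have cu : cvg (u @ \oo).
  apply/cauchy_cvgP/cauchy_exP => e e0.
  have e20 : 0 < e / 2 by rewrite divr_gt0.
  have [n ne] := filter_ex (inv_small _ e20).
  exists (u n); apply: filterS (inv_small _ e20) => m me.
  rewrite -ball_normE /ball_/= (le_lt_trans (uuF _ _))// [ltRHS]splitr.
  by rewrite ltrD// (lt_le_trans (uF _)).
exists (lim (u @ \oo)); apply/val_inj/funext => phi.
rewrite -[LHS]/(phi (lim (u @ \oo))).
have cphi : phi (u n) @[n --> \oo] --> (phi (lim (u @ \oo)) : R).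
  exact: cvg_comp cu (@dual_continuous _ _ phi _).
apply: (cvg_unique _ cphi) => //; apply/cvgrPdist_le => e e0.
have p0 : 0 < dual_norm phi + 1 by rewrite ltr_wpDl// dual_norm_ge0.
have ep0 : 0 < e / (dual_norm phi + 1) by rewrite divr_gt0.
apply: filterS (inv_small _ ep0) => n ne.
apply: (le_trans (le_dual_norm (F - bidual_embedding (u n)) phi)).
rewrite -(divfK (lt0r_neq0 p0) e) ler_pM ?dual_norm_ge0//.
  exact: ltW (lt_le_trans (uF n) ne).
by rewrite lerDl.
Qed.

Lemma domain_reflexive : reflexive_space X.
Proof.
move=> F; apply: bidual_closed => d d0; apply: contrapT => /forallNP Fd.
have {}Fd (x : X) : d <= dual_norm (F - bidual_embedding x).
  by rewrite leNgt; apply/negP/Fd.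
pose r := dual_norm F + 1.
have r1 : 1 <= r by rewrite lerDr dual_norm_ge0.
have r0 : 0 < r by exact: lt_le_trans r1.
have [W [UW Wr WF]] : exists W : set_system X, [/\ UltraFilter W,
    \forall x \near W, `|x| <= r &
    forall phi : dual X, phi x @[x --> W] --> (F phi : R)].
  by apply: goldstine => //; rewrite lerDl.
have [K fK] := concentration reflY c0Y cf (ltW r0).
(* This [L] turns the bound [k%:R * r] on the norms into [k%:R * d / 8], below the separation
   [k%:R * d / 2 - 1] for the [k] chosen next. *)
have L0 : 0 < d / 8 / r by rewrite !divr_gt0.
have [T fT] := expanding_escape (K + K) L0.
pose k := (Num.truncn (8 / d * (`|T| + d + 1))).+1.
have k0 : 0 < k%:R :> R by rewrite ltr0n.
have kT : `|T| + d + 1 <= k%:R * d / 8.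
  have : 8 / d * (`|T| + d + 1) < k%:R by exact: truncnS_gt.
  rewrite mulrAC ltr_pdivrMr// => /ltW; rewrite ler_pdivlMr//; lra.
have kl W' : W' \in nseq k W -> W' = W by rewrite mem_nseq => /andP[_ /eqP].
have UWr W' : W' \in nseq k W ->
    UltraFilter W' /\ \forall x \near W', `|x| <= r by move=> /kl->.
have UU : UltraFilter (conv (nseq k W) (0 : X)).
  by apply: conv_ultra => W' /UWr[].
have [v fv] := fK _ UWr.
have := conv_bounded 0 UWr; rewrite size_nseq => bU.
have [x [fx xk]] := filter_ex (filterI fv bU).
(* The distance from [F] to [k%:R^-1 *: x] is at least [d]; scaling by [k] and giving up half of it
   provides a functional. *)
have [phi phi1 phix] : exists2 phi : dual X, dual_norm phi <= 1 &
    k%:R * d / 2 <= `|k%:R * F phi - phi x|.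
  apply: contrapT => /forall2NP Nphi.
  have := Fd (k%:R^-1 *: x); apply/negP; rewrite -ltNge.
  apply: (@le_lt_trans _ _ (d / 2)); last lra.
  apply: dual_norm_le => phi phi1.
  have [//|/negP] := Nphi phi; rewrite -ltNge => /ltW.
  rewrite -[(F - _) phi]/(F phi - phi (k%:R^-1 *: x)).
  have -> : F phi - phi (k%:R^-1 *: x) = k%:R^-1 * (k%:R * F phi - phi x).
    rewrite mulrBr mulrA mulVf ?gt_eqF// mul1r; congr (_ - _).
    by rewrite linearZ.
  by rewrite normrM gtr0_norm ?invr_gt0// ler_pdivrMl// mulrA.
have phiU : phi z @[z --> conv (nseq k W) (0 : X)] --> (k%:R * F phi : R).
  have := @conv_cvg _ _ (nseq k W) 0 phi (F phi).
  rewrite linear0 add0r size_nseq; apply => W' W'k; split.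
    by have [] := UWr _ W'k.
  by rewrite (kl _ W'k).
have phiz1 : \forall z \near conv (nseq k W) (0 : X), `|k%:R * F phi - phi z| <= 1.
  exact: (cvgrPdist_le _ _).1 phiU _ ltr01.
have [z [[fz zk] phiz]] := filter_ex (filterI (filterI fv bU) phiz1).
move: xk zk; rewrite !subr0 => xk zk.
have xz : k%:R * d / 2 - 1 <= `|x - z|.
  have := dual_norm1_le (x - z) phi1; rewrite linearB/= distrC.
  have := ler_distD (phi z : R) (k%:R * F phi) (phi x); lra.
have := fT x z; have -> : T < `|x - z|.
  have := ler_norm T; have := normr_ge0 T; lra.
have -> : d / 8 / r * Num.max `|x| `|z| + d / 8 / r <= `|x - z|.
  have xzk : Num.max `|x| `|z| <= k%:R * r by rewrite ge_max xk.
  have := ler_wpM2l (ltW L0) xzk.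
  rewrite [k%:R * r]mulrC [_ / r * (r * _)]mulrA divfK ?gt_eqF//.
  have : d / 8 / r <= d / 8 by rewrite ler_pdivrMr// ler_peMr// divr_ge0 ?(ltW d0).
  have := normr_ge0 T; lra.
move=> /(_ isT isT); apply/negP; rewrite -leNgt.
rewrite (_ : f x - f z = (f x - v) - (f z - v)); last first.
  by rewrite opprB addrA subrK.
exact: le_trans (ler_normB _ _) (lerD fx fz).
Qed.

End Expanding.

(** * Trees of weakly null ultrafilters *)

Section ConvexConvolution.
Context (R : realType) (V : normedModType R).
Implicit Types (l : seq (set_system V)) (u : V) (H : V -> R).

Lemma conv_shift l u v (A : set V) :
  conv l (u + v) A = conv l v [set z | A (u + z)].
Proof.
elim: l v => [|W l IH] v /=; last first.
  by rewrite /bind; congr (W _); apply/funext => x; rewrite -addrA IH.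
by apply/propext; split=> /principal_filterP ?; apply/principal_filterP.
Qed.

Lemma conv_lsc l u H e :
  (forall W, W \in l -> UltraFilter W /\ weakly_null W) ->
  convex_fun H -> nonexpansive H -> 0 < e ->
  \forall z \near conv l u, H u - e <= H z.
Proof.
move=> + cH lH; elim: l u e => [|W l IH] u e Ul e0 /=.
  by apply/principal_filterP; rewrite lerBlDr lerDl ltW.
have [UW W0] := Ul _ (mem_head _ _).
have {}Ul W' : W' \in l -> UltraFilter W' /\ weakly_null W'.
  by move=> lW'; apply: Ul; rewrite inE lW' orbT.
have e20 : 0 < e / 2 by rewrite divr_gt0.
apply: (@filterS _ W _ _ _ _ (weakly_null_lsc u _ W0 cH lH e20)) => x xu.
have Ux : UltraFilter (conv l (u + x)) by apply: conv_ultra => W' /Ul[].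
apply: (@filterS _ (conv l (u + x)) _ _ _ _ (IH (u + x) _ Ul e20)) => z; lra.
Qed.

(** A bound at 0 that is uniform over a family makes its averages along a bounded ultrafilter
    exist. *)
Definition lipschitz_convex (M : R) H :=
  [/\ convex_fun H, nonexpansive H & `|H 0| <= M].

Lemma lipschitz_convex_le M H u : lipschitz_convex M H -> `|H u| <= M + `|u|.
Proof.
move=> [_ lH HM]; have := lH u 0; have := lH 0 u.
move: HM; rewrite subr0 sub0r normrN !ler_norml => /andP[? ?] ? ?.
by apply/andP; split; lra.
Qed.

Variables (W : set_system V) (H : V -> V -> R) (M tau : R).
Hypotheses (UW : UltraFilter W) (W1 : \forall x \near W, `|x| <= 1).
Hypotheses (tau1 : `|tau| <= 1) (HM : forall x, lipschitz_convex M (H x)).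

Lemma bounded_along_average u : bounded_along W (fun x => H x (u + tau *: x)).
Proof.
exists (M + (`|u| + 1)); apply: filterS W1 => x x1.
rewrite (le_trans (lipschitz_convex_le _ (HM x)))// lerD2l.
by rewrite (le_trans (ler_normD _ _))// lerD2l normrZ mulr_ile1.
Qed.

Lemma lipschitz_convex_average :
  lipschitz_convex (M + 1) (fun u => ulim W (fun x => H x (u + tau *: x))).
Proof.
have bW := bounded_along_average; split.
- move=> u v t t01; apply/ler_addgt0Pr => e e0.
  apply: ulim_le => //; have [t0 t1] := andP t01.
  apply: filterS2 (ulim_near UW (bW u) e0) (ulim_near UW (bW v) e0) => x.
  rewrite !ler_norml => /andP[_ xu] /andP[_ xv].
  have [cH _ _] := HM x; have := cH (u + tau *: x) (v + tau *: x) t t01.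
  rewrite (_ : _ + _ *: (_ + _) = t *: u + (1 - t) *: v + tau *: x); last first.
    by rewrite !scalerDr addrACA -scalerDl [t + _]addrC subrK scale1r.
  have := ler_wpM2l t0 xu.
  have t1' : 0 <= 1 - t by rewrite subr_ge0.
  have := ler_wpM2l t1' xv; lra.
- move=> u v; apply/ler_addgt0Pr => e e0.
  apply: ulim_le => //; apply: filterS (ulim_near UW (bW v) e0) => x.
  have [_ lH _] := HM x; have := lH (u + tau *: x) (v + tau *: x).
  by rewrite opprD addrACA subrr addr0 !ler_norml => ? /andP[? ?]; lra.
- have near0 : \forall x \near W, `|H x (0 + tau *: x)| <= M + 1.
    apply: filterS W1 => x x1.
    rewrite (le_trans (lipschitz_convex_le _ (HM x)))// lerD2l.
    by rewrite add0r normrZ mulr_ile1.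
  rewrite ler_norml; apply/andP; split.
    by apply: le_ulim => //; apply: filterS near0 => x; rewrite ler_norml => /andP[].
  by apply: ulim_le => //; apply: filterS near0 => x; rewrite ler_norml => /andP[].
Qed.

End ConvexConvolution.

Section Trees.
Context (R : realType) (X : normedModType R).
Variables (W : seq X -> set_system X) (tau : nat -> R).
Hypotheses (W0 : forall s, weakly_null_ultra 1 (W s)).
Hypotheses (tau1 : forall i, `|tau i| <= 1).

Let UW s : UltraFilter (W s). Proof. by have [] := W0 s. Qed.
Let W1 s : \forall x \near W s, `|x| <= 1. Proof. by have [] := W0 s. Qed.

(* The iterated limit of [`|u + sum of the tau-weighted vertices|] over the
   branches of length [m] that start at the node [s] of the tree [W]. *)
Fixpoint branch_average m s (u : X) : R :=
  if m is m'.+1 then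
    ulim (W s) (fun x => branch_average m' (rcons s x) (u + tau (size s) *: x))
  else `|u|.

Lemma lipschitz_convex_branch m s : lipschitz_convex m%:R (branch_average m s).
Proof.
elim: m s => [|m IH] s.
  split; [exact: convex_norm|exact: nonexpansive_norm|].
  by rewrite /= !normr0.
rewrite -natr1; exact: (@lipschitz_convex_average _ _ (W s)
  (fun x => branch_average m (rcons s x))).
Qed.

Definition scaled_node s : set_system X := (fun x => tau (size s) *: x) @ W s.

Lemma scaled_node_weakly_null s : weakly_null_ultra 1 (scaled_node s).
Proof.
have UWs := UW s; split; first exact: fmap_ultra.
  apply: (@filterS _ (W s) _ _ _ _ (W1 s)) => x x1.
  by rewrite /= normrZ mulr_ile1.
move=> phi; apply/cvgr0Pnorm_le => e e0.
have [_ _ Ws0] := W0 s.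
apply: (@filterS _ (W s) _ _ _ _ (weakly_null_le phi _ Ws0 e0)) => x xe.
rewrite /= linearZ normrZ; apply: le_trans xe.
by rewrite -[leRHS]mul1r ler_wpM2r.
Qed.

Let rows (F : seq (seq X)) := [seq scaled_node s | s <- F].

Let rowsP F A : A \in rows F -> weakly_null_ultra 1 A.
Proof. by move=> /mapP[s _ ->]; exact: scaled_node_weakly_null. Qed.

(** Draws before the first occurrence of [s] are discarded by weak lower semicontinuity, the draw at
    [s] supplies [x], and [conv_lsc] discards the later ones. *)
Lemma conv_rows_branch m (F : seq (seq X)) s u e : s \in F -> 0 < e ->
  \forall z \near conv (rows F) u, exists x,
    branch_average m.+1 s u - e <= branch_average m (rcons s x) z.
Proof.
elim: F u e => // s' F IH u e; rewrite inE => sF e0; have UWs' := UW s'.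
have e20 : 0 < e / 2 by rewrite divr_gt0.
have UF v : UltraFilter (conv (rows F) v).
  by apply: conv_ultra => A /rowsP[].
have [->|ss'] := eqVneq s s'.
  have HM x := lipschitz_convex_branch m (rcons s' x).
  have := ulim_near UWs'
    (bounded_along_average UWs' (W1 s') (tau1 (size s')) HM u) e20.
  apply: (@filterS _ (W s')) => x; rewrite ler_norml => /andP[xe _].
  have [cH lH _] := lipschitz_convex_branch m (rcons s' x).
  have := conv_lsc (u + tau (size s') *: x) _ cH lH e20.
  move=> /(_ (rows F))h.
  apply: (@filterS _ (conv (rows F) _) _ _ _ _ (h _)).
    by move=> z ze; exists x; move: xe ze => /=; lra.
  by move=> A /rowsP[].
have {}sF : s \in F by move: sF; rewrite (negPf ss').
have [cH lH _] := lipschitz_convex_branch m.+1 s.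
have [UN _ s'0] := scaled_node_weakly_null s'.
apply: (@filterS _ (scaled_node s') _ _ _ _
  (weakly_null_lsc u _ s'0 cH lH e20)) => x xe.
apply: (@filterS _ (conv (rows F) _) _ _ _ _ (IH (u + x) _ sF e20)).
by move=> z [y yz]; exists y; move: xe yz; set a := branch_average _ _ _; lra.
Qed.

Variable fine : set_system (seq (seq X)).
Hypotheses (Ufine : UltraFilter fine).
Hypothesis fineP : forall s, \forall F \near fine, s \in F.

(* Every node eventually belongs to [F], so this single ultrafilter, which does
   not depend on the branch, contains one child of whichever node the branch has
   reached. *)
Definition level_sum : set_system X := bind fine (fun F => conv (rows F) 0).

Let Urows F u : UltraFilter (conv (rows F) u).
Proof. by apply: conv_ultra => A /rowsP[]. Qed.

Let Ulevel m u : UltraFilter (conv (nseq m level_sum) u).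
Proof.
apply: conv_ultra => A; rewrite mem_nseq => /andP[_ /eqP->].
exact: bind_ultra.
Qed.

(* The vertices off the branch are drawn independently of those on the branch, so
   weak lower semicontinuity of the remaining average allows dropping them. *)
Lemma conv_level_branch m s u e : 0 < e ->
  \forall z \near conv (nseq m level_sum) u, branch_average m s u - e <= `|z|.
Proof.
elim: m s u e => [|m IH] s u e e0.
  by apply/principal_filterP; rewrite /= lerBlDr lerDl ltW.
have e20 : 0 < e / 2 by rewrite divr_gt0.
(* Adding [u] to a level sum amounts to starting the rows at [u], as [conv_rows_branch] requires. *)
have levelE A : level_sum [set z | conv (nseq m level_sum) (u + z) A] =
  \forall F \near fine, conv (rows F) u [set z | conv (nseq m level_sum) z A].
  rewrite /level_sum /bind; congr (fine _); apply/funext => F.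
  by rewrite -[in RHS](addr0 u) conv_shift.
pose B := [set w : X | branch_average m.+1 s u - e <= `|w|].
change (level_sum [set z | conv (nseq m level_sum) (u + z) B]); rewrite levelE.
apply: (@filterS _ fine _ _ _ _ (fineP s)) => F sF.
have Ux := Urows F u.
apply: (@filterS _ (conv (rows F) u) _ _ _ _ (conv_rows_branch m u sF e20)).
move=> z [x xz]; have Uz := Ulevel m z.
apply: (@filterS _ (conv (nseq m level_sum) z) _ _ _ _ (IH (rcons s x) z _ e20)).
move=> w; apply: le_trans; move: xz.
by set a := branch_average m.+1 s u; set b := branch_average _ _ _; lra.
Qed.

(** [A] bounds the iterated limits for all finite [F] at once, so the norm bound survives the limit
    along [fine]. *)
Lemma level_sum_weakly_null A :
  (forall l, (forall U, U \in l -> weakly_null_ultra 1 U) ->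
    ulim (conv l (0 : X)) (fun z => `|z|) <= A) ->
  weakly_null_ultra (A + 1) level_sum.
Proof.
move=> lA; have UL : UltraFilter level_sum by exact: bind_ultra.
split=> //.
  apply: (@filterE _ fine) => F; have UF := Urows F 0.
  have bF : bounded_along (conv (rows F) (0 : X)) (fun z => `|z|).
    by apply: (@bounded_along_conv_norm _ _ _ 1) => U /rowsP[].
  have FA := lA (rows F) (@rowsP F).
  apply: (@filterS _ (conv (rows F) 0) _ _ _ _ (ulim_near UF bF ltr01)) => z.
  by rewrite ler_norml => /andP[_ ?]; lra.
move=> phi; apply/cvgr0Pnorm_le => e e0.
apply: (@filterE _ fine) => F; have UF := Urows F 0.
have := @conv_cvg _ _ (rows F) 0 phi 0.
rewrite linear0 mulr0 addr0 => h.
by apply: (cvgr0Pnorm_le _).1 e e0; apply: h => U /rowsP[].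
Qed.

Fixpoint tree m s : set_system (seq X) :=
  if m is m'.+1 then bind (W s) (fun x => tree m' (rcons s x))
  else principal_filter s.

Lemma tree_ultra m s : UltraFilter (tree m s).
Proof.
elim: m s => [|m IH] s /=; first exact: principal_filter_ultra.
exact: bind_ultra.
Qed.

Definition weighted_sum (s : seq X) := \sum_(i < size s) tau i *: s`_i.

Lemma weighted_sum_rcons s x :
  weighted_sum (rcons s x) = weighted_sum s + tau (size s) *: x.
Proof.
rewrite /weighted_sum size_rcons big_ord_recr/= nth_rcons ltnn eqxx.
by congr (_ + _); apply: eq_bigr => i _; rewrite nth_rcons ltn_ord.
Qed.

Lemma tree_branch_average m s c :
  (\forall t \near tree m s, c <= `|weighted_sum t|) ->
  c <= branch_average m s (weighted_sum s).
Proof.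
elim: m s => [|m IH] s /=; first by move/principal_filterP.
move=> tc; have UWs := UW s.
apply: le_ulim => //.
  exact: (bounded_along_average UWs (W1 s) (tau1 (size s))
    (fun x => lipschitz_convex_branch m (rcons s x))).
apply: (@filterS _ (W s) _ _ _ _ tc) => x /IH.
by rewrite weighted_sum_rcons.
Qed.

End Trees.

(* Take the signs of [phi (x i)] for a norming functional [phi] of the sum. *)
Lemma signs_bound (R : realType) (V : normedModType R) n (x : 'I_n -> V) C
    (a : 'I_n -> R) m : 0 <= m -> (forall i, `|a i| <= m) ->
  (forall b : {ffun 'I_n -> bool}, `|\sum_(i < n) (-1) ^+ b i *: x i| <= C) ->
  `|\sum_(i < n) a i *: x i| <= C * m.
Proof.
move=> m0 am xC; have [phi phi1 <-] := norming_functional (\sum_(i < n) a i *: x i).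
have := xC [ffun i => phi (x i) < 0].
set S := \sum_(i < n) _ => SC.
have phiS : phi S <= C.
  exact: le_trans (ler_norm _) (le_trans (dual_norm1_le S phi1) SC).
apply: le_trans (ler_wpM2r m0 phiS).
rewrite !linear_sum/= mulr_suml; apply: ler_sum => i _; rewrite !linearZ/= ffunE.
apply: (le_trans (ler_norm _)); rewrite normrZ.
apply: (le_trans (ler_wpM2r (normr_ge0 _) (am i))).
rewrite mulrC ler_wpM2r// -[_ *: phi (x i)]/(_ * phi (x i)).
have [h|h] := ltrP (phi (x i)) 0.
  by rewrite ltr0_norm// expr1 mulN1r.
by rewrite ger0_norm// expr0 mul1r.
Qed.

(** * From bounded weakly null sums to the asymptotic-c_0 game *)

Section AsymptoticC0.
Context (R : realType) (X : completeNormedModType R).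

Lemma fine_ultrafilter (T : choiceType) : exists2 W : set_system (seq T),
  UltraFilter W & forall x, \forall F \near W, x \in F.
Proof.
pose B (l : seq T) := [set F : seq T | {subset l <= F}].
have [|l l'|l|W UW BW] := @ultra_extension _ _ B.
- exact: (inhabits [::]).
- exists (l ++ l') => F lF.
  by split=> x xl; apply: lF; rewrite mem_cat xl ?orbT.
- by exists l.
by exists W => // x; apply: filterS (BW [:: x]) => F; apply; rewrite mem_head.
Qed.

Lemma principal_weakly_null : weakly_null_ultra 1 (principal_filter (0 : X)).
Proof.
have U0 := principal_filter_ultra (0 : X); split=> //.
  by apply/principal_filterP; rewrite normr0.
move=> phi; apply/cvgr0Pnorm_le => e e0; apply/principal_filterP.
by rewrite linear0 normr0 ltW.
Qed.

(** At a lost position every member of [cof] contains a vector of the unit ball that keeps the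
    position lost; such vectors carry a weakly null ultrafilter. *)
Lemma lost_game_tree n (P : seq X -> Prop) : ~ cof_game n P [::] ->
  exists2 W : seq X -> set_system X, forall s, weakly_null_ultra 1 (W s) &
    \forall t \near tree W n [::], size t = n /\ ~ P t.
Proof.
(* The length of [s] determines the number of rounds left, so one ultrafilter per node suffices. *)
move=> lost; pose winning s (W : set_system X) := weakly_null_ultra 1 W /\
  forall m, (size s + m.+1)%N = n -> ~ cof_game m.+1 P s ->
    \forall x \near W, ~ cof_game m P (rcons s x).
have /choice[W WP] : forall s, exists W, winning s W.
  move=> s; have [[m [sm lose]]|nolose] := pselect (exists m,
      (size s + m.+1)%N = n /\ ~ cof_game m.+1 P s); last first.
    exists (principal_filter 0); split; first exact: principal_weakly_null.
    by move=> m sm lose; case: nolose; exists m.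
  have [Z cofZ|W W0 WS] := @cof_weakly_null_ultra _ _
    [set x | ~ cof_game m P (rcons s x)].
    apply: contrapT => /forallNP Zgame; apply: lose => /=.
    exists Z => // x Zx x1; apply: contrapT => xlose; apply: (Zgame x).
    by split.
  exists W; split=> // m' sm' _.
  by move: sm'; rewrite -sm => /addnI[->].
exists W => [s|]; first by have [] := WP s.
suff : forall m s, (size s + m)%N = n -> ~ cof_game m P s ->
    \forall t \near tree W m s, size t = n /\ ~ P t.
  exact.
have UW s : UltraFilter (W s) by have [[]] := WP s.
elim=> [|m IH] s sm slose.
  by apply/principal_filterP; rewrite -sm addn0.
have [_ /(_ m sm slose)Ws] := WP s.
apply: (@filterS _ (W s) _ _ _ _ Ws) => x xlose; apply: IH => //.
by rewrite size_rcons addSnnS.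
Qed.

(** The bound serves twice: at radius 1 it controls the level sums, and at radius [A1 + 1] it
    controls the sum of [n] copies of a level sum. *)
Lemma asymptotic_c0_of_conv_bound :
  (forall r : R, 0 <= r -> exists2 A : R, 0 <= A & forall l,
    (forall W, W \in l -> weakly_null_ultra r W) ->
    ulim (conv l (0 : X)) (fun z => `|z|) <= A) ->
  asymptotic_c0 X.
Proof.
move=> bound; have [A1 A10 A1P] := bound 1 ler01.
have [A2 A20 A2P] := bound (A1 + 1) (addr_ge0 A10 ler01).
have [fine Ufine fineP] := fine_ultrafilter (seq X).
(* The slack 3 exceeds the two unit errors, one in the limit of the norms and one in
   [conv_level_branch]. *)
exists (A2 + 3); first lra.
move=> n; apply: contrapT => /lost_game_tree[W W0 lost].
(* The signs are extended by 0 beyond [n], which keeps every weight at most 1 in absolute value. *)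
pose tau (b : {ffun 'I_n -> bool}) (i : nat) : R :=
  if insub i is Some j then (-1) ^+ b j else 0.
have tau1 b i : `|tau b i| <= 1.
  rewrite /tau; case: insubP => [j _ _|_]; last by rewrite normr0.
  by rewrite normrX normrN1 expr1n.
have UW s : UltraFilter (W s) by have [] := W0 s.
have Ut : UltraFilter (tree W n [::]) by apply: tree_ultra.
have tb b : \forall t \near tree W n [::], `|weighted_sum (tau b) t| <= A2 + 3.
  have [//|big] := in_ultra_setVsetC
    [set t | `|weighted_sum (tau b) t| <= A2 + 3] Ut.
  have : A2 + 3 <= branch_average W (tau b) n [::] 0.
    have := @tree_branch_average _ _ W (tau b) W0 (tau1 b) n [::] (A2 + 3).
    rewrite /weighted_sum big_ord0; apply.
    by apply: filterS big => t /negP; rewrite -ltNge => /ltW.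
  pose V := level_sum W (tau b) fine.
  have V0 : weakly_null_ultra (A1 + 1) V by exact: level_sum_weakly_null.
  have VA W' : W' \in nseq n V -> weakly_null_ultra (A1 + 1) W'.
    by rewrite mem_nseq => /andP[_ /eqP->].
  have UV : UltraFilter (conv (nseq n V) (0 : X)).
    by apply: conv_ultra => W' /VA[].
  have bV : bounded_along (conv (nseq n V) (0 : X)) (fun z => `|z|).
    by apply: (@bounded_along_conv_norm _ _ _ (A1 + 1)) => W' /VA[].
  have := A2P _ VA.
  have [z [za zb]] := filter_ex (filterI (ulim_near UV bV ltr01)
    (@conv_level_branch _ _ W (tau b) W0 (tau1 b) fine Ufine fineP n [::] 0 1 ltr01)).
  by move: za zb; rewrite ler_norml => /andP[? ?] ? ? ?; lra.
(* There are finitely many sign patterns, so a single lost branch satisfies all the bounds. *)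
have [t [[tn nPt] tle]] := filter_ex (filterI lost (filter_forall _ tb)).
apply: nPt => a; apply: signs_bound => [|i|b].
- exact: bigmax_ge_id.
- exact: (le_bigmax _ (fun i => `|a i|)).
have := tle b; rewrite /weighted_sum tn; congr (`|_| <= _).
by apply: eq_bigr => i _; rewrite /tau valK.
Qed.

End AsymptoticC0.

Theorem corollary1p6 (R : realType) (X Y : completeNormedModType R) :
  reflexive_space Y -> asymptotic_c0 Y ->
  (exists f : X -> Y, coarse f /\ expanding_at_rate1 f) ->
  reflexive_space X /\ asymptotic_c0 X.
Proof.
move=> reflY c0Y [f [cf ef]]; split; first exact: domain_reflexive ef.
by apply: asymptotic_c0_of_conv_bound => r; exact: weakly_null_conv_bound ef _.
Qed.
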